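(* Let $K\hookrightarrow L$ be a simplicial pair. For each integer $q\ge 0$, the $q$-th persistent Betti number equals the nullity of the $q$-th persistent Laplacian: $$\beta_q^{K,L}=\dim\ker\left(\Delta_q^{K,L}\right).$$
   Context: A simplicial complex $K$ over a finite totally ordered set $V$ is a collection of nonempty subsets of $V$ closed under taking nonempty subsets. $S_q^K$ is the set of $q$-simplices (elements of cardinality $q+1$) and $n_q^K=|S_q^K|$. Every complex $K$ carries a weight function $w^K:K\to(0,\infty)$, and $w_q^K$ is its restriction to $S_q^K$. For $\sigma\in S_q^K$, $[\sigma]$ is $\sigma$ oriented by the order of $V$. $C_q^K$ is the real vector space with basis $\{[\sigma]:\sigma\in S_q^K\}$ (and $C_{-1}^K=0$), with the inner product $\langle[\sigma],[\sigma']\rangle_{w_q^K}=\delta_{\sigma\sigma'}\,(w_q^K(\sigma))^{-1}$. The boundary operator $\partial_q^K:C_q^K\to C_{q-1}^K$ is $\partial_q^K[v_0,\dots,v_q]=\sum_{i=0}^q(-1)^i[v_0,\dots,\hat v_i,\dots,v_q]$ for $q\geq 1$, and $\partial_0^K=0$. A simplicial pair $K\hookrightarrow L$ consists of simplicial complexes $K\subseteq L$ over the same ordered set $V$ with $w^K=w^L|_K$. Put $C_{q}^{L,K}=\{c\in C_q^L:\partial_q^L c\in C_{q-1}^K\}$, with the inner product restricted from $C_q^L$, and let $\partial_q^{L,K}:C_q^{L,K}\to C_{q-1}^K$ be the restriction of $\partial_q^L$. With $*$ denoting adjoints for these inner products, the $q$-th persistent Laplacian is the operator on $C_q^K$ $$\Delta_q^{K,L}=\partial_{q+1}^{L,K}(\partial_{q+1}^{L,K})^*+(\partial_q^K)^*\partial_q^K.$$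 The $q$-th persistent Betti number $\beta_q^{K,L}$ is the rank of the map $H_q(K)\to H_q(L)$ induced by inclusion on simplicial homology with real coefficients. *)

(* Defs.v *)
From HB Require Import structures.
From mathcomp Require Import all_boot all_order all_algebra.
From mathcomp Require Import generic_quotient ring_quotient sesquilinear.
From mathcomp Require Import reals.

Set Implicit Arguments.
Unset Strict Implicit.
Unset Printing Implicit Defensive.

Import Order.TTheory GRing.Theory Num.Theory.

Local Open Scope ring_scope.
Local Open Scope quotient_scope.

(* The quotient of a finite-dimensional space by a subspace, as a vectType
   on the library's zmodType quotient. *)
Section QuotientSpace.
Variables (F : fieldType) (vT : vectType F) (B : {vspace vT}).

Definition quotv := Quotient.quot (pred_of_vspace B).

HB.instance Definition _ := GRing.Zmodule.on quotv.

Definition quotv_pi (x : vT) : quotv :=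
  \pi_(Quotient.quot (pred_of_vspace B)) x.

Lemma quotv_piP x y : (quotv_pi x == quotv_pi y) = (x - y \in B).
Proof. by rewrite /quotv_pi -Quotient.idealrBE. Qed.

Lemma quotv_reprK (a : quotv) : quotv_pi (repr a) = a.
Proof. exact: reprK. Qed.

Lemma quotv_piD x y : quotv_pi (x + y) = quotv_pi x + quotv_pi y.
Proof. by rewrite /quotv_pi Quotient.pi_add. Qed.

Definition scaleq (a : F) (u : quotv) : quotv := quotv_pi (a *: repr u).

Lemma scaleq_pi a x : scaleq a (quotv_pi x) = quotv_pi (a *: x).
Proof.
apply/eqP; rewrite quotv_piP -scalerBr memvZ//.
by rewrite -quotv_piP quotv_reprK.
Qed.

Fact scaleqA a b u : scaleq a (scaleq b u) = scaleq (a * b) u.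
Proof. by rewrite -[u]quotv_reprK !scaleq_pi scalerA. Qed.

Fact scale1q : left_id 1 scaleq.
Proof. by move=> u; rewrite -[u]quotv_reprK !scaleq_pi scale1r. Qed.

Fact scaleqDr : right_distributive scaleq +%R.
Proof.
move=> a u v; rewrite -[u]quotv_reprK -[v]quotv_reprK.
by rewrite -quotv_piD !scaleq_pi scalerDr quotv_piD.
Qed.

Fact scaleqDl u : {morph scaleq^~ u : a b / a + b}.
Proof.
by move=> a b; rewrite -[u]quotv_reprK !scaleq_pi scalerDl quotv_piD.
Qed.

HB.instance Definition _ :=
  GRing.Zmodule_isLmodule.Build F quotv scaleqA scale1q scaleqDr scaleqDl.

Fact quotv_pi_linear : linear quotv_pi.
Proof. by move=> a x y; rewrite quotv_piD -scaleq_pi. Qed.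

HB.instance Definition _ :=
  GRing.isLinear.Build F vT quotv _ quotv_pi quotv_pi_linear.

Fact quotv_vect_iso : Vector.axiom (\dim (B^C)%VS) quotv.
Proof.
pose p (x : vT) := x - projv B x.
have pP x : p x \in (B^C)%VS by exact: memv_projC.
have pE x : p (repr (quotv_pi x)) = p x.
  have /projv_id : repr (quotv_pi x) - x \in B by rewrite -quotv_piP quotv_reprK.
  rewrite linearB => e; apply/eqP; rewrite -subr_eq0 /p opprD opprK addrACA -{1}e.
  by rewrite [- _ + _]addrC subrKA subrr.
have pi_p x : quotv_pi (p x) = quotv_pi x.
  by apply/eqP; rewrite quotv_piP /p addrAC subrr add0r memvN memv_proj.
have p_id x : x \in (B^C)%VS -> p x = x.
  move=> xC; rewrite /p; suff -> : projv B x = 0 by rewrite subr0.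
  by apply/eqP; rewrite -memv_ker lker_proj.
exists (fun u : quotv => \row_i coord (vbasis (B^C)%VS) i (p (repr u))).
  move=> k u v; rewrite -[u]quotv_reprK -[v]quotv_reprK -linearP !pE.
  have -> : p (k *: repr u + repr v) = k *: p (repr u) + p (repr v).
    by rewrite /p linearP scalerBr opprD addrACA.
  by apply/rowP=> i; rewrite !mxE linearP.
exists (fun r : 'rV_(\dim (B^C)%VS) =>
          quotv_pi (\sum_i r 0 i *: (vbasis (B^C)%VS)`_i)).
  move=> u; rewrite -[RHS]quotv_reprK -[RHS]pi_p; congr quotv_pi.
  rewrite [RHS](coord_vbasis (pP _)).
  by apply: eq_bigr => i _; rewrite mxE.
move=> r; apply/rowP=> i; rewrite mxE pE p_id.
  by rewrite coord_sum_free ?(basis_free (vbasisP _)).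
by apply: rpred_sum => j _; rewrite rpredZ ?vbasis_mem ?memt_nth.
Qed.

HB.instance Definition _ := Lmodule_hasFinDim.Build F quotv quotv_vect_iso.

End QuotientSpace.

Lemma linfunE (F : fieldType) (U W : vectType F) (f : U -> W) :
  linear f -> linfun f =1 f.
Proof.
move=> fL x; pose f' : {linear U -> W} :=
  HB.pack f (GRing.isLinear.Build _ _ _ _ f fL).
exact: (lfunE f').
Qed.

Section Adjoint.
Variable (R : realType).

Section Def.
Variables (U W : vectType R).
Variables (fU : {dot U for idfun}) (fW : {dot W for idfun}) (h : 'Hom(U, W)).

Lemma adjoint_subproof :
  {g : 'Hom(W, U) | forall x y, fW (h x) y = fU x (g y)}.
Proof.
pose phi y : 'Hom(U, R^o) := linfun (fun x : U => fU x y : R^o).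
have phiE y x : phi y x = fU x y.
  by rewrite linfunE// => a u v; exact: (linearPl fU).
pose Phi := linfun phi.
have PhiE y : Phi y = phi y.
  rewrite linfunE// => a u v; apply/lfunP => x.
  by rewrite phiE add_lfunE scale_lfunE !phiE linearPr.
have ker0 : lker Phi == 0%VS.
  apply/eqP/vspaceP => y; rewrite memv0 memv_ker; apply/idP/idP => [|/eqP->].
    apply: contraTT => y0; have fy : 0 < fU y y by exact: neq0_dnorm_gt0.
    apply: contraTN fy => /eqP/lfunP/(_ y).
    by rewrite PhiE phiE zero_lfunE => ->; rewrite ltxx.
  by rewrite linear0.
have imT : limg Phi = fullv.
  apply/eqP; rewrite eqEdim subvf limg_dim_eq ?(eqP ker0) ?capv0//.
  by rewrite !dimvf /dim/= muln1.
pose psi y : 'Hom(U, R^o) := linfun (fun x : U => fW (h x) y : R^o).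
have psiE y x : psi y x = fW (h x) y.
  rewrite linfunE// => a u v; rewrite linearP; exact: (linearPl fW).
pose g := linfun (fun y => (Phi^-1)%VF (psi y)).
exists g => x y; rewrite linfunE; last first.
  move=> a u v; rewrite -linearP; congr (_ _); apply/lfunP => z.
  by rewrite add_lfunE scale_lfunE !psiE linearPr.
by rewrite -phiE -PhiE limg_lfunVK ?psiE// imT memvf.
Qed.

(* By adjointP and nondegeneracy of fU, this is the unique adjoint of h for
   the inner products fU and fW. *)
Definition adjoint := sval adjoint_subproof.

Lemma adjointP x y : fW (h x) y = fU x (adjoint y).
Proof. exact: (svalP adjoint_subproof). Qed.

End Def.

Section Restriction.
Variables (U : vectType R) (f : {dot U for idfun}) (X : {vspace U}).

Definition subdot (x y : subvs_of X) : R := f (vsval x) (vsval y).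

Fact subdot_bilinear : bilinear_for
  (GRing.Scale.Law.clone _ _ *%R _) (GRing.Scale.Law.clone _ _ (idfun \; *%R) _)
  subdot.
Proof.
split=> [y|x] a u v; first exact: (linearPl f (vsval y) a (vsval u) (vsval v)).
exact: (linearPr f (vsval x) a (vsval u) (vsval v)).
Qed.

Fact subdot_sym x y : subdot x y = (-1) ^+ false * idfun (subdot y x).
Proof. exact: (@hermitian_subproof _ _ _ _ f). Qed.

Fact subdot_gt0 x : x != 0 -> 0 < subdot x x.
Proof. by move=> x0; apply: neq0_dnorm_gt0; rewrite raddf_eq0//; apply: subvs_inj. Qed.

HB.instance Definition _ :=
  bilinear_isBilinear.Build R (subvs_of X) (subvs_of X) R _ _ subdot
    subdot_bilinear.
HB.instance Definition _ :=
  isHermitianSesquilinear.Build R (subvs_of X) false idfun subdot subdot_sym.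
HB.instance Definition _ :=
  isDotProduct.Build R (subvs_of X) subdot subdot_gt0.

End Restriction.

End Adjoint.

Section Complexes.
Variables (R : realType) (d : Order.disp_t) (V : finOrderType d).

(* Only the values of [weight] on simplices are meaningful. *)
Record wcomplex := WComplex {
  simplices : {set {set V}};
  weight : {set V} -> R;
  simplex_neq0 : forall s : {set V}, s \in simplices -> s != set0;
  simplex_sub : forall s t : {set V},
    s \in simplices -> t \subset s -> t != set0 -> t \in simplices;
  weight_gt0 : forall s : {set V}, s \in simplices -> 0 < weight s
}.

Definition simplicial_pair (K L : wcomplex) : Prop :=
  simplices K \subset simplices L /\
  {in simplices K, forall s, weight K s = weight L s}.

(* Simplices and chains are indexed by cardinality instead of dimension:
   S_q^K is [simplex K q.+1] and C_q^K is [chain K q.+1].  As the empty set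
   is not a simplex, C_{-1}^K is [chain K 0], the zero space (chain0). *)
Definition simplex (K : wcomplex) (k : nat) :=
  {s : {set V} | (s \in simplices K) && (#|s| == k)}.

Definition chain (K : wcomplex) (k : nat) := {ffun simplex K k -> R^o}.
HB.instance Definition _ K k := Vector.on (chain K k).

(* The basis chain [A]; it is 0 when A is not in [simplex K k]. *)
Definition elt (K : wcomplex) (k : nat) (A : {set V}) : chain K k :=
  [ffun s => (val s == A)%:R].

(* [Order.enum_val i] is the i-th vertex of s in the order of V. *)
Definition bd_simplex (K : wcomplex) k (s : {set V}) : chain K k :=
  \sum_(i < #|s|) (-1) ^+ i *: elt K k (s :\ Order.enum_val i).

(* [bd K q] is the boundary operator from C_q^K to C_{q-1}^K. *)
Definition bd (K : wcomplex) k : 'Hom(chain K k.+1, chain K k) :=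
  linfun (fun c : chain K k.+1 => \sum_s c s *: bd_simplex K k (val s)).

(* The inclusion of C^K in C^L, meaningful for a simplicial pair. *)
Definition incl (K L : wcomplex) k : 'Hom(chain K k, chain L k) :=
  linfun (fun c : chain K k => \sum_s c s *: elt L k (val s)).

Section Extend.
Variables (K : wcomplex) (k : nat) (W : vectType R) (f : {set V} -> W).

Lemma extend_linear :
  linear (fun c : chain K k => \sum_s c s *: f (val s)).
Proof.
move=> a u v; rewrite scaler_sumr -big_split; apply: eq_bigr => s _ /=.
by rewrite !ffunE scalerDl scalerA.
Qed.

Lemma extend_elt s : s \in simplices K -> #|s| = k ->
  linfun (fun c : chain K k => \sum_s c s *: f (val s)) (elt K k s) = f s.
Proof.
move=> sK sk; have sP : (s \in simplices K) && (#|s| == k) by rewrite sK sk eqxx.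
rewrite linfunE; last exact: extend_linear.
rewrite (bigD1 (Sub s sP : simplex K k))//= ffunE SubK eqxx scale1r big1 ?addr0//.
move=> t; rewrite -val_eqE SubK ffunE => /negPf->.
by rewrite scale0r.
Qed.

End Extend.

Lemma bd_elt K k s : s \in simplices K -> #|s| = k.+1 ->
  bd K k (elt K k.+1 s) = bd_simplex K k s.
Proof. exact: extend_elt. Qed.

Lemma incl_elt K L k s : s \in simplices K -> #|s| = k ->
  incl K L k (elt K k s) = elt L k s.
Proof. exact: extend_elt. Qed.

Lemma elt_decomp K k (c : chain K k) : c = \sum_s c s *: elt K k (val s).
Proof.
apply/ffunP => t; rewrite sum_ffunE (bigD1 t)//= !ffunE eqxx [_ *: _]mulr1.
rewrite big1 ?addr0// => s /negPf st; rewrite !ffunE val_eqE eq_sym st.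
exact: mulr0.
Qed.

Lemma chain_lfunP K k (W : vectType R) (f g : 'Hom(chain K k, W)) :
  (forall s, s \in simplices K -> #|s| = k -> f (elt K k s) = g (elt K k s)) ->
  f = g.
Proof.
move=> fg; apply/lfunP => c; rewrite (elt_decomp c) !linear_sum.
apply: eq_bigr => s _; rewrite !linearZ; congr (_ *: _).
by have /andP[sK /eqP sk] := valP s; apply: fg.
Qed.

Lemma chain0 K (c : chain K 0) : c = 0.
Proof.
apply/ffunP => s; have /andP[sK /eqP/cards0_eq s0] := valP s.
by have := simplex_neq0 sK; rewrite s0 eqxx.
Qed.

Definition cdot (K : wcomplex) k (c c' : chain K k) : R :=
  \sum_s c s * c' s / weight K (val s).

Section CdotInst.
Variables (K : wcomplex) (k : nat).

Fact cdot_sym (x y : chain K k) : cdot x y = (-1) ^+ false * idfun (cdot y x).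
Proof.
by rewrite expr0 mul1r; apply: eq_bigr => s _; rewrite [x s * _]mulrC.
Qed.

Fact cdotP (y : chain K k) : GRing.linear_for *%R (@cdot K k ^~ y).
Proof.
move=> a u v; rewrite /cdot mulr_sumr -big_split; apply: eq_bigr => s _ /=.
by rewrite !ffunE !mulrDl !mulrA.
Qed.

Fact cdot_bilinear : bilinear_for
  (GRing.Scale.Law.clone _ _ *%R _) (GRing.Scale.Law.clone _ _ (idfun \; *%R) _)
  (@cdot K k).
Proof.
split=> [y|x]; first exact: cdotP.
by move=> a u v; rewrite ![cdot x _]cdot_sym !mul1r /= cdotP.
Qed.

Fact cdot_gt0 (x : chain K k) : x != 0 -> 0 < cdot x x.
Proof.
move=> x0; have w0 (s : simplex K k) : 0 < weight K (val s).
  by apply: weight_gt0; have /andP[] := valP s.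
have t0 (s : simplex K k) : 0 <= x s * x s / weight K (val s).
  by rewrite divr_ge0 ?sqr_ge0 -?expr2 ?ltW ?w0// sqr_ge0.
rewrite lt_def sumr_ge0// andbT psumr_eq0//; apply: contra x0 => /allP xs0.
apply/eqP/ffunP => s; have /= := xs0 s (mem_index_enum s).
by rewrite !mulf_eq0 invr_eq0 (gt_eqF (w0 s)) orbF orbb ffunE => /eqP.
Qed.

HB.instance Definition _ :=
  bilinear_isBilinear.Build R (chain K k) (chain K k) R _ _ (@cdot K k)
   cdot_bilinear.
HB.instance Definition _ :=
  isHermitianSesquilinear.Build R (chain K k) false idfun (@cdot K k) cdot_sym.
HB.instance Definition _ :=
  isDotProduct.Build R (chain K k) (@cdot K k) cdot_gt0.

End CdotInst.

Lemma bd_simplexE K k s : bd_simplex K k s =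
  \sum_(v in s) (-1) ^+ #|[set u in s | (u < v)%O]| *: elt K k (s :\ v).
Proof.
rewrite /bd_simplex -[RHS]big_enum/=.
rewrite -(perm_big _ (permEl (perm_sort <=%O (enum s))))/=.
have [x0 _|s0] := pickP (mem s); last first.
  rewrite big1 => [|i _]; last by have := Order.enum_valP i; rewrite [_ \in _]s0.
  by rewrite big1_seq// => v; rewrite mem_sort mem_enum [_ \in _]s0.
rewrite (big_nth x0) -/(Order.enum s) -Order.cardE big_mkord.
apply: eq_bigr => i _; rewrite -Order.enum_val_nth; congr (_ ^+ _ *: _).
have -> : [set u in s | (u < Order.enum_val i)%O] =
          [set Order.enum_val j | j : 'I_#|s| & (j < i)%N].
  apply/setP => u; rewrite inE; apply/andP/imsetP => [[us ui]|[j ji ->]].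
    exists (Order.enum_rank_in us u); last by rewrite Order.enum_rankK_in.
    move: ui; rewrite -{1}(Order.enum_rankK_in us us) inE.
    by rewrite (leW_mono (@Order.le_enum_val _ _ _ _)).
  split; first exact: Order.enum_valP.
  by move: ji; rewrite inE (leW_mono (@Order.le_enum_val _ _ _ _)).
rewrite card_imset; last exact: Order.enum_val_inj.
rewrite -sum1dep_card; symmetry.
rewrite -(big_ord_widen _ (fun=> 1%N)) ?sum1_card ?card_ord//.
exact: ltnW.
Qed.

Lemma incl_bd K L k : simplicial_pair K L ->
  (incl K L k \o bd K k = bd L k \o incl K L k.+1)%VF.
Proof.
move=> [KL _]; apply: chain_lfunP => s sK sk.
rewrite !comp_lfunE bd_elt// incl_elt// bd_elt ?(subsetP KL)// !bd_simplexE.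
rewrite linear_sum; apply: eq_bigr => v vs; rewrite linearZ; congr (_ *: _).
case: k sk => [|k] sk; first by rewrite [LHS]chain0 [RHS]chain0.
have svk : #|s :\ v| = k.+1 by move: sk; rewrite (cardsD1 v) vs => -[].
apply: incl_elt => //; apply: (simplex_sub sK); first exact: subsetDl.
by rewrite -card_gt0 svk.
Qed.

Lemma bd_bd K k : (bd K k \o bd K k.+1 = 0)%VF.
Proof.
apply: chain_lfunP => s sK sk; rewrite comp_lfunE zero_lfunE bd_elt// bd_simplexE.
rewrite linear_sum.
have bdf v : v \in s -> bd K k (elt K k.+1 (s :\ v)) = bd_simplex K k (s :\ v).
  move=> vs; have svk : #|s :\ v| = k.+1 by move: sk; rewrite (cardsD1 v) vs => -[].
  apply: bd_elt => //; apply: (simplex_sub sK); first exact: subsetDl.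
  by rewrite -card_gt0 svk.
pose p (A : {set V}) v := #|[set u in A | (u < v)%O]|.
pose G v w : chain K k := (-1) ^+ p s v *: ((-1) ^+ p (s :\ v) w *: elt K k (s :\ v :\ w)).
transitivity (\sum_(v in s) \sum_(w in s | w != v) G v w).
  apply: eq_bigr => v vs; rewrite linearZ/= bdf// bd_simplexE scaler_sumr.
  by apply: eq_bigl => w; rewrite !inE andbC.
have pD v w : v \in s -> p s w = ((v < w)%O + p (s :\ v) w)%N.
  move=> vs; rewrite /p (cardsD1 v) inE vs; congr (_ + _)%N.
  by apply: eq_card => u; rewrite !inE andbA.
have GG v w : v \in s -> w \in s -> (v < w)%O -> G v w = - G w v.
  move=> vs ws vw; rewrite /G !scalerA -!exprD (pD w v)// (pD v w)// vw.
  rewrite lt_gtF// add0n add1n addSn exprS addnC mulN1r scaleNr opprK.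
  by congr (_ *: elt _ _ _); rewrite !setDDl // setUC.
have swapK : cancel (fun x : V * V => (x.2, x.1)) (fun x => (x.2, x.1)) by case.
rewrite pair_big_dep/=.
rewrite (bigID (fun x => x.1 < x.2)%O)/=.
rewrite [X in X + _](eq_bigr (fun x => - G x.2 x.1)); last first.
  by move=> [v w]/= /andP[/and3P[vs ws _] vw]; apply: GG.
rewrite sumrN (reindex_inj (can_inj swapK))/= addrC.
apply/eqP; rewrite subr_eq0; apply/eqP; apply: eq_bigl => -[v w]/=.
by rewrite -leNgt; case: (v \in s); case: (w \in s); case: (ltgtP v w).
Qed.

Definition cycles (K : wcomplex) (q : nat) : {vspace chain K q.+1} :=
  lker (bd K q).

Definition boundaries (K : wcomplex) (q : nat) :
    {vspace subvs_of (cycles K q)} :=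
  (linfun vsval @^-1: limg (bd K q.+1))%VS.

Definition homology (K : wcomplex) (q : nat) := quotv (boundaries K q).
HB.instance Definition _ K q := Vector.on (homology K q).

Definition homology_map (K L : wcomplex) (q : nat) :
    'Hom(homology K q, homology L q) :=
  linfun (fun a : homology K q => quotv_pi (boundaries L q)
    (vsproj (cycles L q) (incl K L q.+1 (vsval (repr a))))).

Lemma incl_cycle K L q (z : subvs_of (cycles K q)) : simplicial_pair K L ->
  incl K L q.+1 (vsval z) \in cycles L q.
Proof.
move=> KL; rewrite memv_ker -comp_lfunE -incl_bd// comp_lfunE.
by have := subvsP z; rewrite memv_ker => /eqP->; rewrite linear0.
Qed.

Lemma mem_boundaries K q (z : subvs_of (cycles K q)) :
  (z \in boundaries K q) = (vsval z \in limg (bd K q.+1)).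
Proof. by rewrite -memv_preim lfunE. Qed.

Lemma homology_mapE K L q (z : subvs_of (cycles K q)) : simplicial_pair K L ->
  homology_map K L q (quotv_pi (boundaries K q) z) =
  quotv_pi (boundaries L q) (vsproj (cycles L q) (incl K L q.+1 (vsval z))).
Proof.
move=> KL; pose f (y : subvs_of (cycles K q)) := vsproj (cycles L q) (incl K L q.+1 (vsval y)).
have fB (y : subvs_of (cycles K q)) : y \in boundaries K q -> f y \in boundaries L q.
  rewrite !mem_boundaries vsprojK ?incl_cycle// => /memv_imgP[c _ ->].
  by rewrite -comp_lfunE incl_bd// comp_lfunE memv_img ?memvf.
have fE y : quotv_pi (boundaries L q) (f (repr (quotv_pi (boundaries K q) y))) =
            quotv_pi (boundaries L q) (f y).
  apply/eqP; rewrite quotv_piP /f -!linearB; apply: fB.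
  by rewrite -quotv_piP quotv_reprK.
rewrite linfunE; first exact: fE.
move=> a u v; rewrite -[u]quotv_reprK -[v]quotv_reprK -linearP !fE.
by rewrite /f !linearP.
Qed.

Definition pbetti (K L : wcomplex) (q : nat) : nat :=
  \dim (limg (homology_map K L q)).

(* [pchain K L q] is C_q^{L,K}, the chains of C_q^L with boundary in the
   copy of C_{q-1}^K inside C_{q-1}^L. *)
Definition pchain (K L : wcomplex) (k : nat) : {vspace chain L k.+1} :=
  (bd L k @^-1: limg (incl K L k))%VS.

(* The boundary, brought back to C_{q-1}^K along the inclusion (incl_pbd). *)
Definition pbd (K L : wcomplex) (k : nat) :
    'Hom(subvs_of (pchain K L k), chain K k) :=
  ((incl K L k)^-1 \o (bd L k \o linfun vsval))%VF.

Lemma incl_pbd K L k (c : subvs_of (pchain K L k)) :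
  incl K L k (pbd K L k c) = bd L k (vsval c).
Proof.
rewrite !comp_lfunE lfunE limg_lfunVK//.
by have := subvsP c; rewrite -memv_preim.
Qed.

Definition bd_adj (K : wcomplex) (k : nat) : 'Hom(chain K k, chain K k.+1) :=
  adjoint (@cdot K k.+1) (@cdot K k) (bd K k).

Definition pbd_adj (K L : wcomplex) (k : nat) :
    'Hom(chain K k, subvs_of (pchain K L k)) :=
  adjoint (subdot (@cdot L k.+1) (X := pchain K L k)) (@cdot K k) (pbd K L k).

Definition plaplacian (K L : wcomplex) (q : nat) : 'End(chain K q.+1) :=
  (pbd K L q.+1 \o pbd_adj K L q.+1)%VF + (bd_adj K q \o bd K q)%VF.

End Complexes.

(* Main.v *)
Require Import Defs.
From mathcomp Require Import all_boot all_order all_algebra.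
From mathcomp Require Import sesquilinear.
From mathcomp Require Import reals.

(** Write [A] for the persistent boundary and [D] for the boundary of [K], so
    that the persistent Laplacian is [A A^* + D^* D] with [D A = 0].  Both sides
    of the equality are [dim ker D - dim im A].

    On the analytic side, pairing [A A^* y + D^* D y] with [y] gives
    [|A^* y|^2 + |D y|^2], so the kernel of the Laplacian is the kernel of [A^*]
    on [ker D].  The rank of [A^*] on [ker D] is that of [A]: it is at least
    that, because [im A] lies in [ker D] and [A^*] is injective on [im A], and at
    most that, because [A] is injective on [im A^*]
    ([dim_lker_hodge_laplacian]).

    On the homological side, the map induced on homology has the same image as
    its composite with the projection from the cycles of [K].  A cycle [z] of
    [K] is killed by this composite when it bounds some chain [c] of [L]; such a
    [c] has its boundary in [K], hence is a persistent chain, and [A c = z]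
    because the inclusion of chains is injective.  So the composite has kernel
    [im A] ([dim_pbetti]). *)

Import Order.TTheory GRing.Theory Num.Theory.
Local Open Scope ring_scope.

Section Hodge.
Set Implicit Arguments.
Context {R : realType}.

Lemma dot_eq0 (U : vectType R) (f : {dot U for idfun}) (x : U) :
  f x x = 0 -> x = 0.
Proof.
move=> fx0; apply/eqP; apply: contraT => /(neq0_dnorm_gt0 (s := f)).
by rewrite fx0 ltxx.
Qed.

Lemma dot_ge0 (U : vectType R) (f : {dot U for idfun}) (x : U) : 0 <= f x x.
Proof.
by have [->|/(neq0_dnorm_gt0 (s := f))/ltW//] := eqVneq x 0; rewrite linear0r.
Qed.

Lemma dotC (U : vectType R) (f : {dot U for idfun}) (x y : U) : f x y = f y x.
Proof. by rewrite (@hermitian_subproof _ _ _ _ f) expr0 mul1r. Qed.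

Context {U W X : vectType R}.
Variables (fU : {dot U for idfun}) (fW : {dot W for idfun}).
Variables (fX : {dot X for idfun}).
Variables (A : 'Hom(U, W)) (D : 'Hom(W, X)).

Let A' := adjoint fU fW A.
Let D' := adjoint fW fX D.

(** If [A^* A x = 0] then [|A x|^2], being the product of [x] and [A^* A x],
    vanishes; the next lemma is the same argument with [A] and [A^*] exchanged. *)
Lemma limg_capv_lker_adjoint : (limg A :&: lker A' = 0)%VS.
Proof.
apply/eqP; rewrite -subv0; apply/subvP => _ /memv_capP[/memv_imgP[x _ ->]].
rewrite memv_ker memv0 => /eqP A'A0; apply/eqP/(dot_eq0 fW).
by rewrite (adjointP fU) A'A0 linear0r.
Qed.

Lemma limg_adjoint_capv_lker : (limg A' :&: lker A = 0)%VS.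
Proof.
apply/eqP; rewrite -subv0; apply/subvP => _ /memv_capP[/memv_imgP[y _ ->]].
rewrite memv_ker memv0 => /eqP AA'0; apply/eqP/(dot_eq0 fU).
by rewrite -(adjointP fU fW) AA'0 linear0l.
Qed.

(** Pairing the value at [y] with [y] gives the sum of the two squared norms
    [|A^* y|^2 + |D y|^2], which vanishes only if both do. *)
Lemma lker_hodge_laplacian :
  lker ((A \o A')%VF + (D' \o D)%VF)%R = (lker D :&: lker A')%VS.
Proof.
apply/vspaceP => y; rewrite memv_cap !memv_ker add_lfunE !comp_lfunE.
apply/eqP/andP => [Ly0|[/eqP-> /eqP->]]; last by rewrite !linear0 addr0.
have /eqP : fU (A' y) (A' y) + fX (D y) (D y) = 0.
  by rewrite -(adjointP fU fW) (adjointP fW fX) dotC -linearDr Ly0 linear0r.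
by rewrite paddr_eq0 ?dot_ge0// => /andP[/eqP/dot_eq0-> /eqP/dot_eq0->].
Qed.

(** Rank-nullity for [A^*] restricted to [ker D]; the content is that this
    restriction has the rank of [A]. *)
Lemma dim_lker_hodge_laplacian : (D \o A = 0)%VF ->
  (\dim (lker ((A \o A')%VF + (D' \o D)%VF)%R) + \dim (limg A) =
   \dim (lker D))%N.
Proof.
move=> DA0; rewrite lker_hodge_laplacian -[RHS](limg_ker_dim A'); congr addn.
have imAD : (limg A <= lker D)%VS.
  apply/subvP => _ /memv_imgP[x _ ->].
  by rewrite memv_ker -comp_lfunE DA0 zero_lfunE.
(* [A^*] embeds [im A] in [A^* (ker D)], and [A] embeds [im A^*] in [im A]. *)
apply/eqP; rewrite eqn_leq -{1}(limg_dim_eq limg_capv_lker_adjoint).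
rewrite dimvS ?limgS//= (leq_trans (dimvS (limgS _ (subvf _))))//.
by rewrite -(limg_dim_eq limg_adjoint_capv_lker) dimvS ?limgS ?subvf.
Qed.

End Hodge.

Section PersistentHomology.
Set Implicit Arguments.
Context {R : realType} {d : Order.disp_t} {V : finOrderType d}.
Variables (K L : wcomplex R V).
Hypothesis KL : simplicial_pair K L.

Lemma incl_inj k : injective (incl K L k).
Proof.
move=> c c' /ffunP cc'; apply/ffunP => s.
have /andP[sK sk] := valP s.
have sP : (val s \in simplices L) && (#|val s| == k).
  by rewrite sk (subsetP (proj1 KL)).
have inclE (b : chain K k) : incl K L k b (Sub (val s) sP) = b s.
  rewrite /incl linfunE; last exact: extend_linear.
  rewrite sum_ffunE (bigD1 s)//= !ffunE eqxx [_ *: _]mulr1.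
  rewrite big1 ?addr0// => t /negPf ts.
  by rewrite !ffunE /= val_eqE eq_sym ts; exact: mulr0.
by rewrite -!inclE.
Qed.

(** Persistent chains are all the chains of [L] with boundary in [K], so asking
    for a persistent chain with boundary [z] is no stronger than asking for a
    chain of [L]. *)
Lemma mem_limg_pbd k (z : chain K k) :
  (z \in limg (pbd K L k)) = (incl K L k z \in limg (bd L k)).
Proof.
apply/memv_imgP/memv_imgP => [[c _ ->]|[c _ zc]].
  by exists (vsval c); rewrite ?memvf ?incl_pbd.
have cP : c \in pchain K L k by rewrite -memv_preim -zc memv_img ?memvf.
exists (vsproj _ c); rewrite ?memvf//; apply: incl_inj.
by rewrite incl_pbd vsprojK.
Qed.

Lemma bd_pbd q : (bd K q \o pbd K L q.+1 = 0)%VF.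
Proof.
apply/lfunP => c; apply: (@incl_inj q).
rewrite zero_lfunE linear0 comp_lfunE -[LHS]comp_lfunE incl_bd// comp_lfunE incl_pbd.
by rewrite -comp_lfunE bd_bd zero_lfunE.
Qed.

(** Rank-nullity for the map [h] from the cycles of [K] to the homology of [L]:
    its kernel consists of the cycles of [K] that become boundaries in [L]. *)
Lemma dim_pbetti q :
  (pbetti K L q + \dim (limg (pbd K L q.+1)) = \dim (cycles K q))%N.
Proof.
pose p := linfun (quotv_pi (boundaries K q)).
pose h := (homology_map K L q \o p)%VF.
have -> : pbetti K L q = \dim (limg h).
  congr (\dim _); rewrite limg_comp; congr (_ @: _)%VS.
  apply/vspaceP => a; rewrite memvf; apply/esym/memv_imgP.
  by exists (repr a); rewrite ?memvf// lfunE/= quotv_reprK.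
(* [lker h] lives in the space of cycles, [limg (pbd K L q.+1)] in that of
   chains; [i] is the inclusion of the former in the latter. *)
pose i := linfun (@vsval _ _ (cycles K q)).
have -> : limg (pbd K L q.+1) = (i @: lker h)%VS.
  have hE z : (z \in lker h) = (vsval z \in limg (pbd K L q.+1)).
    rewrite memv_ker comp_lfunE lfunE/= homology_mapE//.
    rewrite -[0](linear0 (quotv_pi (boundaries L q))) quotv_piP subr0.
    by rewrite mem_boundaries vsprojK ?incl_cycle// mem_limg_pbd.
  apply/vspaceP => z; apply/idP/memv_imgP => [zP|[y yh ->]]; last first.
    by rewrite lfunE -hE.
  have zZ : z \in cycles K q.
    have /memv_imgP[c _ ->] := zP.
    by rewrite memv_ker -comp_lfunE bd_pbd zero_lfunE.
  by exists (vsproj _ z); rewrite ?hE ?lfunE/= vsprojK.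
have i_inj : lker i == 0%VS.
  by apply/lker0P => x y; rewrite !lfunE; exact: subvs_inj.
rewrite (limg_dim_eq (f := i)) ?(eqP i_inj) ?capv0//.
rewrite addnC -[lker h]capfv limg_ker_dim.
by rewrite dimvf.
Qed.

End PersistentHomology.

Theorem theorem2p7 (R : realType) (d : Order.disp_t) (V : finOrderType d)
    (K L : wcomplex R V) (q : nat) (hKL : simplicial_pair K L) :
  pbetti K L q = (\dim (lker (plaplacian K L q)))%N.
Proof.
apply: (@addIn (\dim (limg (pbd K L q.+1)))).
by rewrite dim_pbetti// dim_lker_hodge_laplacian ?bd_pbd.
Qed.
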